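(* Let $\theta=\frac{\sqrt{10}-2}{3}$, $\rho=\frac{\sqrt{10}-1}{3}$, and let $\mathbf{s}'=s_1s_2s_3\ldots$ be the Sturmian word of slope $\theta$ and intercept $\rho$, given by $s_n=\lfloor (n+1)\theta+\rho\rfloor-\lfloor n\theta+\rho\rfloor$ for $n\ge1$. Then $\mathrm{rep}(\mathbf{s}')=\sqrt{10}-\frac32$.
   Context: For an infinite word $\mathbf{x}=x_1x_2\ldots$, with $x_i^j=x_i\cdots x_j$, let $r(n,\mathbf{x})=\min\{m\ge1:\ x_i^{i+n-1}=x_{m-n+1}^{m}\text{ for some } 1\le i\le m-n\}$, and $\mathrm{rep}(\mathbf{x})=\liminf_{n\to\infty} r(n,\mathbf{x})/n$. (For these $\theta,\rho$, $n\theta+\rho$ is never an integer for $n\ge1$, so using ceilings instead of floors gives the same word.) *)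

(* Defs.v *)
From HB Require Import structures.
From mathcomp Require Import all_boot all_order all_algebra.
From mathcomp Require Import all_classical all_reals all_analysis.
Set Implicit Arguments. Unset Strict Implicit. Unset Printing Implicit Defensive.
Import Order.TTheory GRing.Theory Num.Theory.

(* An infinite word x = x_1 x_2 ... is a function nat -> int; index 0 is unused. *)

Definition same_factor (x : nat -> int) (n i j : nat) : bool :=
  all (fun k => x (i + k)%N == x (j + k)%N) (iota 0 n).

Definition rep_pred (x : nat -> int) (n m : nat) : bool :=
  (1 <= m)%N && has (fun i => same_factor x n i (m - n + 1)%N) (index_iota 1 (m - n + 1)).

(* r(n, x) = min { m >= 1 : P_n(m) } (defaults to 0 if the set is empty,
   which never happens for words over a finite alphabet). *)
Definition r_fun (x : nat -> int) (n : nat) : nat :=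
  match boolp.pselect (exists m, rep_pred x n m) with
  | left h => ex_minn h
  | right _ => 0%N
  end.

Definition rep (R : realType) (x : nat -> int) : \bar R :=
  limn_einf (fun n : nat => (((r_fun x n)%:R / n%:R : R))%:E).

Definition sturmian (R : realType) (theta rho : R) : nat -> int :=
  fun n => (Num.floor ((n.+1)%:R * theta + rho) - Num.floor (n%:R * theta + rho))%R.

(* Main.v *)
(** Put [rho = theta + 1/3]. Two factors of length [n] starting at [i < i + d] coincide iff
[floor ((m + d) theta + rho) - floor (m theta + rho)] is a constant [c] for [i <= m <= i + n],
i.e. iff no [m] in this window has [m theta + rho] separated from
[m theta + rho + (d theta - c)] by an integer. So everything depends on how the gaps
[d theta - c] compare with the offsets [H theta + rho - M] of very small absolute value.

As [3 theta^2 + 4 theta = 2], multiplication by the unit [1 - 3 theta = 3 - sqrt 10] acts on the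
gaps by an integer matrix and on the offsets by an integer affine map. Iterating the affine map
from [(6, 3)], [(11, 5)], [(24, 10)] gives three families [x_k < y_k < z_k < x_(k+1)] of positions
[H] whose offset is smaller than every gap with [0 < d < H]. If [q] is one of these positions, or
one of the differences [z_k - x_k], [x_(k+1) - y_k], [y_(k+1) - z_k], then the [q] factors of
length [q - 1] starting at [1], ..., [q] are distinct, whence [r(n) >= n + q] for [n >= q - 1].
Conversely the prefix of length [y_(k+1) - 2] occurs again after a shift by [y_(k+1) - z_k].
The smallest ratio arises at [n] close to [y_(k+1)] with [q = y_(k+1) - z_k], and
[1 + (y_(k+1) - z_k) / y_(k+1)] tends to [3 theta + 1/2 = sqrt 10 - 3/2]. *)

Require Import Defs.
From HB Require Import structures.
From mathcomp Require Import all_boot all_order all_algebra.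
From mathcomp Require Import all_classical all_reals all_analysis.
From mathcomp Require Import zify ring lra.
Set Implicit Arguments. Unset Strict Implicit. Unset Printing Implicit Defensive.
Import Order.TTheory GRing.Theory Num.Theory.
Local Open Scope ring_scope.

(** * Floors and equality of Sturmian factors *)

Lemma floor_shift_neq (R : realType) (y e : R) (M : int) :
  (y - M%:~R) * (y + e - M%:~R) < 0 -> Num.floor (y + e) <> Num.floor y.
Proof.
move=> h eqf; have := floor_ge_int y M; rewrite -eqf floor_ge_int.
by case: leP => h1; case: leP => h2 // _; nra.
Qed.

Lemma floor_shift_eq (R : realType) (y e : R) :
  (forall M : int, 0 < (y - M%:~R) * (y + e - M%:~R)) ->
  Num.floor (y + e) = Num.floor y.
Proof.
move=> h; apply/eqP; rewrite eq_le !floor_ge_int; apply/andP; split.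
  by rewrite leNgt; apply/negP => lt1; have := h (Num.floor (y + e));
    have := floor_le (y + e); nra.
by rewrite leNgt; apply/negP => lt1; have := h (Num.floor y);
  have := floor_le y; nra.
Qed.

Lemma floor_orbit_shift (R : realType) (theta rho : R) (m d : nat) (c : int) :
  Num.floor ((m + d)%:R * theta + rho) =
  Num.floor (m%:R * theta + rho + (d%:R * theta - c%:~R)) + c.
Proof.
have -> : m%:R * theta + rho + (d%:R * theta - c%:~R)
  = (m + d)%:R * theta + rho + (- c)%:~R by rewrite natrD; lra.
by rewrite [Num.floor (_ + (- c)%:~R)]floorDrz ?intr_int// intrKfloor subrK.
Qed.

Lemma same_factorP (x : nat -> int) (n i j : nat) :
  reflect (forall k, (k < n)%N -> x (i + k)%N = x (j + k)%N) (same_factor x n i j).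
Proof.
apply: (iffP allP) => [h k kn|h k].
  by apply/eqP/h; rewrite mem_iota.
by rewrite mem_iota => /= kn; apply/eqP/h.
Qed.

Lemma same_factor_leq (x : nat -> int) (n n' i j : nat) :
  (n' <= n)%N -> same_factor x n i j -> same_factor x n' i j.
Proof.
move=> n'n /same_factorP h; apply/same_factorP => k kn.
exact/h/(leq_trans kn).
Qed.

(** Letters are differences of consecutive floors, so equality of [n] letters telescopes to a
    constant difference of floors over [n + 1] positions. *)
Lemma same_factor_sturmianP (R : realType) (theta rho : R) (n i d : nat) :
  reflect (exists c : int, forall m, (i <= m <= i + n)%N ->
    Num.floor ((m + d)%:R * theta + rho) = Num.floor (m%:R * theta + rho) + c)
  (same_factor (sturmian theta rho) n i (i + d)).
Proof.
set f := fun m : nat => Num.floor (m%:R * theta + rho).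
apply: (iffP (same_factorP _ _ _ _)) => [h|[c h] k kn].
  exists (f (i + d)%N - f i) => m /andP[im mn].
  rewrite -(subnKC im); have : (m - i <= n)%N by lia.
  elim: (m - i)%N => [_|k IH kn]; first by rewrite addn0 /f; lia.
  have := IH (ltnW kn); have := h k kn; rewrite /sturmian !addnS !addSn.
  by rewrite (addnAC i k d) -/(f _) -/(f _) -/(f _) -/(f _); lia.
have := h (i + k)%N ltac:(lia); have := h (i + k).+1 ltac:(lia).
by rewrite /sturmian (addnAC i d k) !addSn; lia.
Qed.

Lemma shift_not_const (R : realType) (theta rho : R) (H d : nat) (M c : int) :
  (H%:R * theta + rho - M%:~R) *
    (H%:R * theta + rho - M%:~R + (d%:R * theta - c%:~R)) < 0 ->
  Num.floor ((H + d)%:R * theta + rho) <> Num.floor (H%:R * theta + rho) + c.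
Proof.
move=> h; rewrite (floor_orbit_shift _ _ _ _ c) => /addIr.
apply: (@floor_shift_neq _ _ _ M); lra.
Qed.

Lemma same_factor_sturmian_shift (R : realType) (theta rho : R) (n d : nat) (c : int) :
  (forall m (M : int), (0 < m <= n.+1)%N ->
    0 < (m%:R * theta + rho - M%:~R) *
        (m%:R * theta + rho - M%:~R + (d%:R * theta - c%:~R))) ->
  same_factor (sturmian theta rho) n 1 d.+1.
Proof.
move=> h; rewrite -add1n; apply/same_factor_sturmianP; exists c => m mn.
rewrite (floor_orbit_shift _ _ _ _ c); congr (_ + _).
apply: floor_shift_eq => M; have := h m M ltac:(lia); lra.
Qed.

(** * Near returns and distinct factors *)

Definition distinct_factors (x : nat -> int) (q : nat) : Prop :=
  forall i d, (0 < i)%N -> (0 < d)%N -> (i + d <= q)%N ->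
    ~~ same_factor x q.-1 i (i + d).

(** Squares stand for absolute values, so that a common factor [(1 - 3 * theta) ^+ k] cancels
    whatever its sign. *)
Definition near_return (R : realType) (theta rho : R) (H : nat) (M : int) : Prop :=
  H%:R * theta + rho - M%:~R != 0 /\
  forall (d : nat) (c : int), (0 < d < H)%N ->
    (H%:R * theta + rho - M%:~R) ^+ 2 < (d%:R * theta - c%:~R) ^+ 2.

(** The product of [x * (x + y)] and [x * (x - y)] is negative, and the sign of [x * y] tells which
    factor is. With [x] an offset and [y] a gap, an integer is crossed either by the forward shift
    or by the backward one. *)
Lemma sqr_lt_sign_change (R : realType) (x y : R) : x != 0 -> x ^+ 2 < y ^+ 2 ->
  x * (x + y) < 0 /\ x * y < 0 \/ x * (x - y) < 0 /\ 0 < x * y.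
Proof.
move=> x0 xy; have x2 : 0 < x ^+ 2 by rewrite exprn_even_gt0.
have y0 : y != 0 by apply: contraTneq xy => ->; rewrite -leNgt expr0n ltW.
have : x * y != 0 by rewrite mulf_neq0.
have prod : (x * (x + y)) * (x * (x - y)) < 0.
  have -> : (x * (x + y)) * (x * (x - y)) = x ^+ 2 * (x ^+ 2 - y ^+ 2) by ring.
  by rewrite pmulr_rlt0// subr_lt0.
rewrite neq_lt => /orP[h|h]; [left|right]; split => //.
  by move: prod; rewrite pmulr_llt0//; nra.
by move: prod; rewrite pmulr_rlt0//; nra.
Qed.

(** The window contains both [H] and [H - d]. A gap of sign opposite to the offset separates [H]
    from [H + d]; a gap of the same sign separates [H - d] from [H]. *)
Lemma near_return_window (R : realType) (theta rho : R) (H : nat) (M : int)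
    (n i d : nat) : near_return theta rho H M ->
  (0 < d)%N -> (i + d <= H)%N -> (d < H)%N -> (H <= i + n)%N ->
  ~~ same_factor (sturmian theta rho) n i (i + d).
Proof.
move=> [H0 cl] d0 idH dH Hin; apply/negP => /same_factor_sturmianP[c h].
have := cl d c ltac:(lia) => /(sqr_lt_sign_change H0)[[lt0 _]|[lt0 _]].
  exact: (@shift_not_const _ _ _ _ _ _ _ lt0 (h H ltac:(lia))).
apply: (@shift_not_const _ theta rho (H - d) d (M - c) c _ (h (H - d)%N ltac:(lia))).
by move: lt0; rewrite natrB ?(ltnW dH)// intrB; lra.
Qed.

Lemma distinct_factors_single (R : realType) (theta rho : R) (H : nat) (M : int) :
  near_return theta rho H M -> distinct_factors (sturmian theta rho) H.
Proof.
by move=> nr i d i0 d0 idH; apply: (@near_return_window _ _ _ H M) => //; lia.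
Qed.

(* A window [i, i + q - 1] contains exactly one point of each residue class modulo [q]: one of
   [H0], [H0 + q] and one of [H0 - d], [H0 + q - d]. *)
Lemma distinct_factors_double (R : realType) (theta rho : R) (H0 q : nat) (M0 M1 : int) :
  near_return theta rho H0 M0 -> near_return theta rho (H0 + q) M1 ->
  (H0 <= q)%N ->
  0 < (H0%:R * theta + rho - M0%:~R) * ((H0 + q)%:R * theta + rho - M1%:~R) ->
  (forall (d : nat) (c : int), (0 < d < q)%N ->
    (H0%:R * theta + rho - M0%:~R) * (d%:R * theta - c%:~R) < 0 ->
    (H0%:R * theta + rho - M0%:~R) ^+ 2 < (d%:R * theta - c%:~R) ^+ 2) ->
  distinct_factors (sturmian theta rho) q.
Proof.
move=> nr0 nr1 H0q pos opp i d i0 d0 idq.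
have [iH|iH] := ltnP H0 i.
  by apply: (@near_return_window _ _ _ (H0 + q)%N M1) => //; lia.
apply/negP => /same_factor_sturmianP[c h].
have [nz0 cl0] := nr0; have [nz1 cl1] := nr1.
set D0 : R := _ - M0%:~R in nz0 cl0 pos opp; set D1 : R := _ - M1%:~R in nz1 cl1 pos.
have [neg|nneg] := ltP (D0 * (d%:R * theta - c%:~R)) 0.
  have := opp d c ltac:(lia) neg => /(sqr_lt_sign_change nz0)[[lt0 _]|[_ lt0]].
    exact: (@shift_not_const _ _ _ _ _ _ _ lt0 (h H0 ltac:(lia))).
  lra.
(* The gap is not opposite in sign to [D0] or [D1], so the shift must be tested backward: at
   [H0 - d] if the window contains it, otherwise at [H0 + q - d], which then lies in the window. *)
have [idH|idH] := leqP (i + d) H0.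
  have := cl0 d c ltac:(lia) => /(sqr_lt_sign_change nz0)[[_ lt0]|[lt0 _]]; first lra.
  apply: (@shift_not_const _ theta rho (H0 - d) d (M0 - c) c _ (h (H0 - d)%N ltac:(lia))).
  have -> : (H0 - d)%:R * theta + rho - (M0 - c)%:~R = D0 - (d%:R * theta - c%:~R).
    by rewrite natrB ?intrB ?/D0; [lra|lia].
  by move: lt0; lra.
have := cl1 d c ltac:(lia) => /(sqr_lt_sign_change nz1)[[_ lt0]|[lt0 _]].
  nra.
apply: (@shift_not_const _ theta rho (H0 + q - d) d (M1 - c) c _ (h (H0 + q - d)%N ltac:(lia))).
have -> : (H0 + q - d)%:R * theta + rho - (M1 - c)%:~R = D1 - (d%:R * theta - c%:~R).
  by rewrite natrB ?intrB ?/D1; [lra|lia].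
by move: lt0; lra.
Qed.

(** * Bounds on [r_fun] from repetitions and distinctness *)

Lemma rep_pred_prefix (x : nat -> int) (n d : nat) :
  (0 < d)%N -> same_factor x n 1 d.+1 -> rep_pred x n (n + d).
Proof.
move=> d0 h; rewrite /rep_pred; apply/andP; split; first by lia.
rewrite addKn addn1; apply/hasP; exists 1%N => //.
by rewrite mem_index_iota; lia.
Qed.

Lemma r_fun_le (x : nat -> int) (n m : nat) : rep_pred x n m -> (r_fun x n <= m)%N.
Proof.
move=> h; rewrite /r_fun; case: boolp.pselect => [ex|[]]; last by exists m.
by case: ex_minnP => k _; apply.
Qed.

(** A repetition ending before [n + q] has both starts at most [q], and truncates to length [q.-1].
    The existence of a repetition excludes the default value 0 of [r_fun]. *)
Lemma r_fun_ge (x : nat -> int) (n q : nat) :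
  distinct_factors x q -> (q <= n.+1)%N -> (exists m, rep_pred x n m) ->
  (n + q <= r_fun x n)%N.
Proof.
move=> dist qn; rewrite /r_fun; case: boolp.pselect => // ex _.
case: ex_minnP => m /andP[m1 /hasP[i]]; rewrite mem_index_iota => im same _.
rewrite leqNgt; apply/negP => mnq.
have := dist i (m - n + 1 - i)%N ltac:(lia) ltac:(lia) ltac:(lia).
rewrite subnKC; last by lia.
by rewrite (same_factor_leq _ same)//; lia.
Qed.

(** * The unit action on gaps and offsets *)

Definition theta {R : realType} : R := (Num.sqrt 10 - 2) / 3.

Lemma theta_quad (R : realType) : 3 * theta ^+ 2 + 4 * theta = 2 :> R.
Proof.
have : Num.sqrt 10 ^+ 2 = 10 :> R by rewrite sqr_sqrtr.
by rewrite /theta; lra.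
Qed.

(* The bounds are two consecutive convergents of [theta]. *)
Lemma theta_bounds (R : realType) : 191 / 493 < (theta : R) < 265 / 684.
Proof.
have s0 : 0 <= Num.sqrt 10 :> R by rewrite sqrtr_ge0.
have s2 : Num.sqrt 10 ^+ 2 = 10 :> R by rewrite sqr_sqrtr.
by rewrite /theta; apply/andP; split; nra.
Qed.

(* [lin] and [aff] are multiplication by [1 - 3 theta] on the gaps and on the offsets. *)
Definition lin (v : int * int) : int * int := (5 * v.1 + 3 * v.2, 2 * v.1 + v.2).

Definition aff (v : nat * nat) : nat * nat :=
  (5 * v.1 + 3 * v.2 + 3, 2 * v.1 + v.2 + 2)%N.

Definition gap {R : realType} (v : int * int) : R := v.1%:~R * theta - v.2%:~R.

Definition offset {R : realType} (v : nat * nat) : R :=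
  v.1%:R * theta + (theta + 1 / 3) - v.2%:R.

Lemma gap_iter (R : realType) k v :
  gap (iter k lin v) = (1 - 3 * theta) ^+ k * gap v :> R.
Proof.
elim: k => [|k IH]; first by rewrite mul1r.
rewrite iterS exprS -mulrA -IH; move: (iter k lin v) => [q p].
have := theta_quad R; rewrite /gap /lin /= !rmorphD !rmorphM /= => h.
rewrite -[5%:~R]/5%:R -[3%:~R]/3%:R -[2%:~R]/2%:R.
have -> : (1 - 3 * theta) * (q%:~R * theta - p%:~R) = q%:~R * theta - p%:~R
  + 3 * theta * p%:~R - q%:~R * (3 * theta ^+ 2) :> R by ring.
have -> : 3 * theta ^+ 2 = 2 - 4 * theta :> R by lra.
by ring.
Qed.

Lemma offset_iter (R : realType) k v :
  offset (iter k aff v) = (1 - 3 * theta) ^+ k * offset v :> R.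
Proof.
elim: k => [|k IH]; first by rewrite mul1r.
rewrite iterS exprS -mulrA -IH; move: (iter k aff v) => [q p].
have := theta_quad R; rewrite /offset /aff /= => h.
have -> : (1 - 3 * theta) * (q%:R * theta + (theta + 1 / 3) - p%:R) =
  (q%:R + 1) * theta + 1 / 3 - p%:R - theta + 3 * theta * p%:R - (q%:R + 1) * (3 * theta ^+ 2) :> R by field.
have -> : 3 * theta ^+ 2 = 2 - 4 * theta :> R by lra.
by field.
Qed.

(** The matrix of [lin] has determinant -1, hence an integer inverse, which supplies the witness. *)
Lemma iter_lin_surj k v : exists w, iter k lin w = v.
Proof.
elim: k v => [|k IH] [q p]; first by exists (q, p).
have [w hw] := IH (3 * p - q, 2 * q - 5 * p).
by exists w; rewrite iterS hw /lin /=; congr pair; lia.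
Qed.

(** With [linB], the first row of the [k]-th power of the matrix of [lin]; all positions below are
    compared through these two integers. *)
Definition linA k : int := (iter k lin (1, 0)).1.
Definition linB k : int := (iter k lin (0, 1)).1.

Lemma iter_linE k (q p : int) :
  (iter k lin (q, p)).1 = q * linA k + p * linB k.
Proof.
suff -> : iter k lin (q, p) = (q * linA k + p * linB k,
    q * (iter k lin (1, 0)).2 + p * (iter k lin (0, 1)).2) by [].
elim: k => [|k IH]; first by rewrite /= !mulr1 !mulr0 addr0 add0r.
rewrite /linA /linB !iterS -/(linA k) -/(linB k) IH /lin /=.
by rewrite -/(linA k) -/(linB k); congr pair; lia.
Qed.

Lemma linA_S k : linA k.+1 = 5 * linA k + 2 * linB k.
Proof. by rewrite /linA iterSr (_ : lin (1, 0) = (5, 2))// iter_linE. Qed.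

Lemma linB_S k : linB k.+1 = 3 * linA k + linB k.
Proof. by rewrite /linB iterSr (_ : lin (0, 1) = (3, 1))// iter_linE mul1r. Qed.

Lemma linAB_ge k : 1 <= linA k /\ 0 <= linB k.
Proof.
by elim: k => [|k [hA hB]] //; rewrite linA_S linB_S; lia.
Qed.

(** The map [aff] fixes the rational point (-1, 1/3) and acts around it as [lin]; the factor 3
    clears the denominator. *)
Lemma iter_affE k (H M : nat) :
  3 * ((iter k aff (H, M)).1%:Z + 1) =
  (3 * H%:Z + 3) * linA k + (3 * M%:Z - 1) * linB k.
Proof.
elim: k H M => [|k IH] H M; first by rewrite /linA /linB /=; lia.
by rewrite iterSr /aff /= IH linA_S linB_S; lia.
Qed.

(* The ratio is fixed by the eigenvector (3, -4 - 3 theta) of [lin]. *)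
Lemma linA_linB (R : realType) k :
  (linA k)%:~R - (4 / 3 + theta) * (linB k)%:~R = (1 - 3 * theta) ^+ k :> R.
Proof.
elim: k => [|k IH]; first by rewrite /linA /linB /= expr0; lra.
rewrite exprS -IH linA_S linB_S !rmorphD !rmorphM /=.
rewrite -[5%:~R]/5%:R -[3%:~R]/3%:R -[2%:~R]/2%:R.
set A := (linA k)%:~R; set B := (linB k)%:~R.
have -> : (1 - 3 * theta) * (A - (4 / 3 + theta) * B) = A - 3 * theta * A
  - 4 / 3 * B - theta * B + 4 * theta * B + (3 * theta ^+ 2) * B :> R by field.
have -> : 3 * theta ^+ 2 = 2 - 4 * theta :> R by have := theta_quad R; lra.
by field.
Qed.

(* Write [(d, c)] as [lin^k (x u + y v)]: the bounds on [d] exclude that the integers [x], [y]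
   are both positive or both nonpositive, so the two contributions to the gap do not cancel. *)
Lemma gap_dichotomy (R : realType) k (u v : int * int) (d : nat) (c : int) :
  `|u.1 * v.2 - u.2 * v.1| = 1 ->
  0 <= u.1 -> 0 <= u.2 -> 0 <= v.1 -> 0 <= v.2 ->
  0 < gap u :> R -> gap v < 0 :> R ->
  (0 < d)%N -> d%:Z < (u.1 + v.1) * linA k + (u.2 + v.2) * linB k ->
  exists2 t : R, d%:R * theta - c%:~R = (1 - 3 * theta) ^+ k * t
    & gap u <= t \/ t <= gap v.
Proof.
move: u v => [u1 u2] [v1 v2] /= det u1p u2p v1p v2p gu gv d0 dlt.
have [[e f] ef] := iter_lin_surj k (d%:Z, c).
have [x [y [Ee Ef]]] : exists x y, e = x * u1 + y * v1 /\ f = x * u2 + y * v2.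
  have [D|D] : u1 * v2 - u2 * v1 = 1 \/ u1 * v2 - u2 * v1 = -1 by lia.
    exists (e * v2 - f * v1), (u1 * f - u2 * e).
    by split; rewrite -[LHS]mulr1 -D; ring.
  exists (f * v1 - e * v2), (u2 * e - u1 * f).
  by split; rewrite -[LHS]opprK -mulN1r -D; ring.
exists (gap (e, f)).
  by rewrite -gap_iter ef /gap /=.
have gE : gap (e, f) = x%:~R * gap (u1, u2) + y%:~R * gap (v1, v2) :> R.
  by rewrite /gap /= Ee Ef !rmorphD !rmorphM /=; ring.
have dE : d%:Z = x * (u1 * linA k + u2 * linB k) + y * (v1 * linA k + v2 * linB k).
  by have := iter_linE k e f; rewrite ef /= => ->; rewrite Ee Ef; ring.
have [A1 B0] := linAB_ge k.
have Du : 0 <= u1 * linA k + u2 * linB k by nia.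
have Dv : 0 <= v1 * linA k + v2 * linB k by nia.
have [[x1 y0]|[x0 y1]] : (1 <= x /\ y <= 0) \/ (x <= 0 /\ 1 <= y).
  have [x0|x0] := leP x 0; have [y0|y0] := leP y 0.
  - by nia.
  - by right; lia.
  - by left; lia.
  - by nia.
- left; rewrite gE.
  have : 1 <= x%:~R :> R by rewrite ler1z.
  have : y%:~R <= 0 :> R by rewrite lerz0.
  nra.
- right; rewrite gE.
  have : 1 <= y%:~R :> R by rewrite ler1z.
  have : x%:~R <= 0 :> R by rewrite lerz0.
  nra.
Qed.

(** * Propagation along the orbits of [aff] *)

Lemma lambda_neq0 (R : realType) k : (1 - 3 * theta) ^+ k != 0 :> R.
Proof.
apply: expf_neq0; have /andP[h _] := theta_bounds R; apply/eqP; lra.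
Qed.

(** Since [u + v] dominates [(H + 1, M)], every [d] below the iterated position is in the range of
    [gap_dichotomy]. The power of the unit cancels, leaving one comparison at level 0 for all
    [k]. *)
Lemma near_return_iter (R : realType) k (H M : nat) (u v : int * int) :
  `|u.1 * v.2 - u.2 * v.1| = 1 ->
  0 <= u.1 -> 0 <= u.2 -> 0 <= v.1 -> 0 <= v.2 ->
  H%:Z + 1 <= u.1 + v.1 -> M%:Z <= u.2 + v.2 ->
  offset (H, M) != 0 :> R ->
  `|offset (H, M)| < gap u :> R -> gap v < - `|offset (H, M)| :> R ->
  near_return (theta : R) (theta + 1 / 3)
    (iter k aff (H, M)).1 (iter k aff (H, M)).2%:Z.
Proof.
move=> det u1 u2 v1 v2 Hle Mle o0 ou ov.
have E : (iter k aff (H, M)).1%:R * theta + (theta + 1 / 3)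
    - ((iter k aff (H, M)).2%:Z)%:~R = (1 - 3 * theta) ^+ k * offset (H, M) :> R.
  by rewrite -offset_iter.
split; first by rewrite E mulf_neq0// lambda_neq0.
move=> d c /andP[d0 dH]; rewrite E.
have [A1 B0] := linAB_ge k.
have dlt : d%:Z < (u.1 + v.1) * linA k + (u.2 + v.2) * linB k.
  have := iter_affE k H M; nia.
have on : 0 <= `|offset (H, M)| :> R by [].
have gu : 0 < gap u :> R by lra.
have gv : gap v < 0 :> R by lra.
have [t -> ht] := gap_dichotomy c det u1 u2 v1 v2 gu gv d0 dlt.
rewrite !exprMn ltr_pM2l ?exprn_even_gt0 ?lambda_neq0//.
have : `|offset (H, M)| ^+ 2 < t ^+ 2 :> R by case: ht; nra.
by rewrite real_normK ?num_real.
Qed.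

(** Here [P1 - P0 = u + v], so the range of [gap_dichotomy] is exactly [d < q]. Only gaps of sign
    opposite to [offset P0] matter, whence a one-sided bound instead of one on its absolute
    value. *)
Lemma distinct_factors_iter (R : realType) k (P0 P1 : nat * nat) (u v : int * int) :
  near_return (theta : R) (theta + 1 / 3) (iter k aff P0).1 (iter k aff P0).2%:Z ->
  near_return (theta : R) (theta + 1 / 3) (iter k aff P1).1 (iter k aff P1).2%:Z ->
  `|u.1 * v.2 - u.2 * v.1| = 1 ->
  0 <= u.1 -> 0 <= u.2 -> 0 <= v.1 -> 0 <= v.2 ->
  P1.1%:Z = P0.1%:Z + (u.1 + v.1) -> P1.2%:Z = P0.2%:Z + (u.2 + v.2) ->
  P0.1%:Z + 1 <= u.1 + v.1 -> P0.2%:Z <= u.2 + v.2 ->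
  0 < gap u :> R -> gap v < 0 :> R ->
  0 < offset P0 * offset P1 :> R ->
  gap v < - (offset P0 : R) < gap u ->
  distinct_factors (sturmian (theta : R) (theta + 1 / 3))
    ((iter k aff P1).1 - (iter k aff P0).1).
Proof.
move: P0 P1 => [H0 M0] [H1 M1] /= nr0 nr1 det u1 u2 v1 v2 EH EM Hle Mle gu gv opos.
move=> /andP[ov ou]; have [A1 B0] := linAB_ge k.
have E0 := iter_affE k H0 M0; have E1 := iter_affE k H1 M1.
have qE : (iter k aff (H1, M1)).1%:Z - (iter k aff (H0, M0)).1%:Z =
    (u.1 + v.1) * linA k + (u.2 + v.2) * linB k by nia.
have qge : (iter k aff (H0, M0)).1%:Z <= (u.1 + v.1) * linA k + (u.2 + v.2) * linB k.
  by nia.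
have le01 : ((iter k aff (H0, M0)).1 <= (iter k aff (H1, M1)).1)%N by lia.
have offE (H M : nat) : (iter k aff (H, M)).1%:R * theta + (theta + 1 / 3)
    - ((iter k aff (H, M)).2%:Z)%:~R = (1 - 3 * theta) ^+ k * offset (H, M) :> R.
  by rewrite -offset_iter.
have lam2 : 0 < ((1 - 3 * theta) ^+ k) ^+ 2 :> R.
  by rewrite exprn_even_gt0 ?lambda_neq0.
apply: (@distinct_factors_double _ _ _ (iter k aff (H0, M0)).1 _ _ (iter k aff (H1, M1)).2%:Z nr0).
- by rewrite subnKC.
- by lia.
- rewrite subnKC// !offE.
  have -> : (1 - 3 * theta) ^+ k * offset (H0, M0) * ((1 - 3 * theta) ^+ k * offset (H1, M1))
     = ((1 - 3 * theta) ^+ k) ^+ 2 * (offset (H0, M0) * offset (H1, M1)) :> R by ring.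
  by rewrite pmulr_rgt0.
move=> d c /andP[d0 dq]; rewrite offE.
have dlt : d%:Z < (u.1 + v.1) * linA k + (u.2 + v.2) * linB k by lia.
have [t -> ht] := gap_dichotomy c det u1 u2 v1 v2 gu gv d0 dlt.
have -> : (1 - 3 * theta) ^+ k * offset (H0, M0) * ((1 - 3 * theta) ^+ k * t)
     = ((1 - 3 * theta) ^+ k) ^+ 2 * (offset (H0, M0) * t) :> R by ring.
rewrite pmulr_rlt0// !exprMn ltr_pM2l//.
by case: ht; nra.
Qed.

(** * The three families of positions *)

Definition ptx k := iter k aff (6, 3)%N.
Definition pty k := iter k aff (11, 5)%N.
Definition ptz k := iter k aff (24, 10)%N.

(** Changing the seed expresses level [k.+1] through the same [linA k] and [linB k] as level [k]. *)
Lemma ptx_S k : ptx k.+1 = iter k aff (42, 17)%N. Proof. by rewrite /ptx iterSr. Qed.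
Lemma pty_S k : pty k.+1 = iter k aff (73, 29)%N. Proof. by rewrite /pty iterSr. Qed.

Ltac numeric R :=
  rewrite /gap /offset /=; have /andP[? ?] := theta_bounds R;
  first [ lra | nra | apply/eqP => ?; lra | apply/andP; split; lra
        | rewrite ltr_norml; apply/andP; split; lra
        | rewrite ltrNr ltr_norml; apply/andP; split; lra ].

Lemma near_return_x (R : realType) k :
  near_return (theta : R) (theta + 1 / 3) (ptx k).1 (ptx k).2%:Z.
Proof.
(* The pairs encode 1/3 and 2/5, Farey neighbours on either side of [theta]. The later pairs are
   likewise convergents or intermediate fractions of [theta]. *)
by apply: (@near_return_iter R k 6 3 (3, 1) (5, 2)) => //; numeric R.
Qed.

Lemma near_return_y (R : realType) k :
  near_return (theta : R) (theta + 1 / 3) (pty k).1 (pty k).2%:Z.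
Proof.
by apply: (@near_return_iter R k 11 5 (8, 3) (5, 2)) => //; numeric R.
Qed.

Lemma near_return_z (R : realType) k :
  near_return (theta : R) (theta + 1 / 3) (ptz k).1 (ptz k).2%:Z.
Proof.
by apply: (@near_return_iter R k 24 10 (13, 5) (18, 7)) => //; numeric R.
Qed.

Lemma distinct_factors_x (R : realType) k :
  distinct_factors (sturmian (theta : R) (theta + 1 / 3)) (ptx k).1.
Proof. exact: distinct_factors_single (near_return_x R k). Qed.

Lemma distinct_factors_y (R : realType) k :
  distinct_factors (sturmian (theta : R) (theta + 1 / 3)) (pty k).1.
Proof. exact: distinct_factors_single (near_return_y R k). Qed.

Lemma distinct_factors_z (R : realType) k :
  distinct_factors (sturmian (theta : R) (theta + 1 / 3)) (ptz k).1.
Proof. exact: distinct_factors_single (near_return_z R k). Qed.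

Lemma distinct_factors_zx (R : realType) k :
  distinct_factors (sturmian (theta : R) (theta + 1 / 3)) ((ptz k).1 - (ptx k).1).
Proof.
apply: (@distinct_factors_iter R k (6, 3)%N (24, 10)%N (13, 5) (5, 2)
  (near_return_x R k) (near_return_z R k)) => //; numeric R.
Qed.

Lemma distinct_factors_xy (R : realType) k :
  distinct_factors (sturmian (theta : R) (theta + 1 / 3)) ((ptx k.+1).1 - (pty k).1).
Proof.
have := near_return_x R k.+1; rewrite ptx_S => nr.
apply: (@distinct_factors_iter R k (11, 5)%N (42, 17)%N (13, 5) (18, 7)
  (near_return_y R k) nr) => //; numeric R.
Qed.

Lemma distinct_factors_yz (R : realType) k :
  distinct_factors (sturmian (theta : R) (theta + 1 / 3)) ((pty k.+1).1 - (ptz k).1).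
Proof.
have := near_return_y R k.+1; rewrite pty_S => nr.
apply: (@distinct_factors_iter R k (24, 10)%N (73, 29)%N (31, 12) (18, 7)
  (near_return_z R k) nr) => //; numeric R.
Qed.

(** Positions are measured backward from [Y], the point [pty k.+1]. Up to the unit, the offset at
    [m] is [offset (73, 29) - t]: if [t >= gap (31, 12)] it is negative before and after the shift,
    and if [t <= gap (49, 19)] it is positive both times. Length [Y.1 - 2] makes the window end at
    [Y.1 - 1]. *)
Lemma prefix_repeats (R : realType) k :
  same_factor (sturmian (theta : R) (theta + 1 / 3)) ((pty k.+1).1 - 2) 1
    ((pty k.+1).1 - (ptz k).1).+1.
Proof.
have [A1 B0] := linAB_ge k.
have Ez := iter_affE k 24 10; have Ey := iter_affE k 73 29.
rewrite pty_S -/(ptz k) in Ez *.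
have le01 : ((ptz k).1 <= (iter k aff (73, 29)%N).1)%N by lia.
pose c : int := (iter k aff (73, 29)%N).2%:Z - (ptz k).2%:Z.
apply: (@same_factor_sturmian_shift _ _ _ _ _ c) => m M /andP[m0 mle].
set Y := iter k aff (73, 29)%N in Ey le01 mle c *.
have oY : Y.1%:R * theta + (theta + 1 / 3) - Y.2%:R
    = (1 - 3 * theta) ^+ k * offset (73, 29)%N :> R by rewrite -offset_iter.
have oz : (ptz k).1%:R * theta + (theta + 1 / 3) - (ptz k).2%:R
    = (1 - 3 * theta) ^+ k * offset (24, 10)%N :> R by rewrite -offset_iter.
have etaE : (Y.1 - (ptz k).1)%:R * theta - c%:~R
    = (1 - 3 * theta) ^+ k * gap (49, 19) :> R.
  rewrite natrB// /c intrB -!pmulrn.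
  transitivity ((1 - 3 * theta) ^+ k * (offset (73, 29)%N - offset (24, 10)%N) : R).
    by rewrite mulrBr -oY -oz; lra.
  by congr (_ * _); rewrite /offset /gap /=; lra.
have mY : (m < Y.1)%N by lia.
have det : `|31 * 19 - 12 * 49 : int| = 1 by [].
have gu : 0 < gap (31, 12) :> R by numeric R.
have gv : gap (49, 19) < 0 :> R by numeric R.
have o0 : 0 < offset (73, 29)%N :> R by numeric R.
have ou : offset (73, 29)%N < gap (31, 12) :> R by numeric R.
have [|t dE ht] := @gap_dichotomy R k (31, 12) (49, 19) (Y.1 - m) (Y.2%:Z - M) det
  isT isT isT isT gu gv ltac:(lia).
  by rewrite /=; lia.
have mE : m%:R * theta + (theta + 1 / 3) - M%:~R
    = (1 - 3 * theta) ^+ k * (offset (73, 29)%N - t) :> R.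
  by rewrite mulrBr -oY -dE natrB ?(ltnW mY)// intrB -!pmulrn; lra.
rewrite etaE mE.
have -> : (1 - 3 * theta) ^+ k * (offset (73, 29)%N - t) *
    ((1 - 3 * theta) ^+ k * (offset (73, 29)%N - t) + (1 - 3 * theta) ^+ k * gap (49, 19))
  = ((1 - 3 * theta) ^+ k) ^+ 2 * ((offset (73, 29)%N - t) *
     (offset (73, 29)%N - t + gap (49, 19))) :> R by ring.
rewrite pmulr_rgt0 ?exprn_even_gt0 ?lambda_neq0//.
by case: ht => ht; nra.
Qed.

(** * Density estimates *)

Lemma lambda_norm_le1 (R : realType) k : -1 <= ((1 - 3 * theta) ^+ k : R) <= 1.
Proof.
rewrite -ler_norml normrX exprn_ile1//.
have /andP[h1 h2] := theta_bounds R.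
by rewrite ler_norml; apply/andP; split; lra.
Qed.

(** Eliminating [linA] by [linA_linB] leaves a multiple of [linB] and a bounded remainder. The
    factor [3 * theta - 1 / 2] is the target limit minus 1. *)
Lemma density_expand (R : realType) k (a b a' b' : R) :
  (3 * theta - 1 / 2) * (a * (linA k)%:~R + b * (linB k)%:~R)
    - (a' * (linA k)%:~R + b' * (linB k)%:~R) =
  (a * (4 / 3 - theta / 2) + b * (3 * theta - 1 / 2) - a' * (4 / 3 + theta) - b')
    * (linB k)%:~R + (1 - 3 * theta) ^+ k * (a * (3 * theta - 1 / 2) - a').
Proof.
rewrite -linA_linB.
set A := (linA k)%:~R; set B := (linB k)%:~R.
apply/eqP; rewrite -subr_eq0; apply/eqP.
transitivity (a * B * (3 * theta ^+ 2 + 4 * theta - 2) : R); first by field.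
by rewrite theta_quad subrr mulr0.
Qed.

(** The last hypothesis makes the coefficient of [linB] nonpositive; the remainder is at most 300,
    so 500 is a generous constant. *)
Lemma density_le (R : realType) k (n q a b a' b' : nat) :
  3 * n%:Z <= a%:Z * linA k + b%:Z * linB k ->
  a'%:Z * linA k + b'%:Z * linB k <= 3 * q%:Z + 3 ->
  (a <= 300)%N -> (a' <= 300)%N ->
  a%:R * (4 / 3 - theta / 2) + b%:R * (3 * theta - 1 / 2)
    <= a'%:R * (4 / 3 + theta) + b'%:R :> R ->
  (3 * theta - 1 / 2) * n%:R <= q%:R + 500 :> R.
Proof.
move=> hn hq ha ha' hk.
have /andP[t1 t2] := theta_bounds R.
have /andP[l1 l2] := lambda_norm_le1 R k.
have := density_expand k (a%:R : R) b%:R a'%:R b'%:R.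
have {}hn : 3 * n%:R <= a%:R * (linA k)%:~R + b%:R * (linB k)%:~R :> R.
  by move: hn; rewrite -(ler_int R) !rmorphD !rmorphM.
have {}hq : a'%:R * (linA k)%:~R + b'%:R * (linB k)%:~R <= 3 * q%:R + 3 :> R.
  by move: hq; rewrite -(ler_int R) !rmorphD !rmorphM.
have B0 : 0 <= (linB k)%:~R :> R by rewrite ler0z; case: (linAB_ge k).
have {}ha : a%:R <= 300 :> R by rewrite (ler_nat R a 300).
have {}ha' : a'%:R <= 300 :> R by rewrite (ler_nat R a' 300).
have a0 : 0 <= a%:R :> R by [].
have a0' : 0 <= a'%:R :> R by [].
move: hn hq B0 ha ha' a0 a0' l1 l2 hk.
move: ((1 - 3 * theta) ^+ k) (linA k)%:~R (linB k)%:~R => l A B.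
move=> hn hq B0 ha ha' a0 a0' l1 l2 hk E.
set K : R := (_ - _ - _) in E.
have KB : K * B <= 0 by rewrite mulr_le0_ge0// /K; lra.
have m1 : -300 <= a%:R * (3 * theta - 1 / 2) - a'%:R :> R by nra.
have m2 : a%:R * (3 * theta - 1 / 2) - a'%:R <= 300 :> R by nra.
have le300 : l * (a%:R * (3 * theta - 1 / 2) - a'%:R) <= 300 by nra.
have : (3 * theta - 1 / 2) * (3 * n%:R) <=
  (3 * theta - 1 / 2) * (a%:R * A + b%:R * B) by rewrite ler_pM2l//; lra.
lra.
Qed.

(** * Linear bounds on [r_fun] *)

Lemma pty_lt k : ((pty k).1 < (pty k.+1).1)%N.
Proof. by rewrite -[pty k.+1]/(aff (pty k)); case: (pty k) => H M; rewrite /aff /=; lia. Qed.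

Lemma pty_ge k : (k <= (pty k).1)%N.
Proof. by elim: k => // k IH; apply: leq_ltn_trans IH (pty_lt k). Qed.

Lemma repeats_exist (R : realType) n :
  exists m, rep_pred (sturmian (theta : R) (theta + 1 / 3)) n m.
Proof.
exists (n + ((pty n.+2.+1).1 - (ptz n.+2).1))%N.
apply: rep_pred_prefix.
  have := iter_affE n.+2 73 29; have := iter_affE n.+2 24 10; have := linAB_ge n.+2.
  rewrite pty_S /ptz; lia.
apply: same_factor_leq (prefix_repeats R n.+2); have := pty_ge n.+3; lia.
Qed.

Lemma y_bracket n : (11 <= n)%N -> exists k, ((pty k).1 <= n < (pty k.+1).1)%N.
Proof.
elim: n => // n IH; rewrite leq_eqVlt => /predU1P[<-|/IH[k /andP[h1 h2]]].
  by exists 0%N.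
have [h|h] := ltnP n.+1 (pty k.+1).1; first by exists k; lia.
by exists k.+1; have := pty_lt k.+1; lia.
Qed.

Lemma r_fun_lower (R : realType) n : (11 <= n)%N ->
  (3 * theta + 1 / 2) * n%:R - 500 <=
    (r_fun (sturmian (theta : R) (theta + 1 / 3)) n)%:R :> R.
Proof.
move=> n11; have [|k /andP[ky ky']] := @y_bracket n.+1; first by lia.
suff [q [dq qn hq]] : exists q, [/\ distinct_factors (sturmian (theta : R) (theta + 1 / 3)) q,
    (q <= n.+1)%N & (3 * theta - 1 / 2) * n%:R <= q%:R + 500 :> R].
  have := r_fun_ge dq qn (repeats_exist R n).
  rewrite -(ler_nat R) natrD; lra.
have /andP[t1 t2] := theta_bounds R.
have [A1 B0] := linAB_ge k.
have Ex := iter_affE k 6 3; have Ey := iter_affE k 11 5; have Ez := iter_affE k 24 10.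
have Ex' := iter_affE k 42 17; have Ey' := iter_affE k 73 29.
move: ky ky'; rewrite -/(ptx k) -/(pty k) -/(ptz k) -ptx_S -pty_S in Ex Ey Ez Ex' Ey' * => ky ky'.
(* Six values of [q], with leading coefficients 11, 18, 24, 31, 42, 49, cover the bracket; each
   serves until [n.+1] reaches the next. The numbers given to [density_le] come from [iter_affE],
   first for that upper end, then for [q]. *)
have [h1|h1] := ltnP n.+1 ((ptz k).1 - (ptx k).1).
  exists (pty k).1; split; [exact: distinct_factors_y|lia|].
  by apply: (@density_le R k n _ 54 21 36 14) => //; [lia|lia|lra].
have [h2|h2] := ltnP n.+1 (ptz k).1.
  exists ((ptz k).1 - (ptx k).1)%N; split; [exact: distinct_factors_zx|lia|].
  by apply: (@density_le R k n _ 75 29 54 21) => //; [lia|lia|lra].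
have [h3|h3] := ltnP n.+1 ((ptx k.+1).1 - (pty k).1).
  exists (ptz k).1; split; [exact: distinct_factors_z|lia|].
  by apply: (@density_le R k n _ 93 36 75 29) => //; [lia|lia|lra].
have [h4|h4] := ltnP n.+1 (ptx k.+1).1.
  exists ((ptx k.+1).1 - (pty k).1)%N; split; [exact: distinct_factors_xy|lia|].
  by apply: (@density_le R k n _ 129 50 93 36) => //; [lia|lia|lra].
have [h5|h5] := ltnP n.+1 ((pty k.+1).1 - (ptz k).1).
  exists (ptx k.+1).1; split; [exact: distinct_factors_x|lia|].
  by apply: (@density_le R k n _ 147 57 129 50) => //; [lia|lia|lra].
(* The critical range: the comparison required by [density_le] is an equality, both sides being
   [253 + 147 * theta]. *)
exists ((pty k.+1).1 - (ptz k).1)%N; split; [exact: distinct_factors_yz|lia|].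
by apply: (@density_le R k n _ 222 86 147 57) => //; [lia|lia|lra].
Qed.

Lemma r_fun_upper (R : realType) (N : nat) : exists2 n, (N <= n)%N &
  (r_fun (sturmian (theta : R) (theta + 1 / 3)) n)%:R
    <= (3 * theta + 1 / 2) * n%:R + 500 :> R.
Proof.
pose k := N.+2; exists ((pty k.+1).1 - 2)%N; first by have := pty_ge k.+1; rewrite /k; lia.
have [A1 B0] := linAB_ge k.
have Ez := iter_affE k 24 10; have Ey' := iter_affE k 73 29.
rewrite -/(ptz k) -pty_S in Ez Ey'.
have d0 : (0 < (pty k.+1).1 - (ptz k).1)%N by lia.
have := r_fun_le (rep_pred_prefix d0 (prefix_repeats R k)).
rewrite -(ler_nat R) natrD => /le_trans; apply.
set n := ((pty k.+1).1 - 2)%N; set q := ((pty k.+1).1 - (ptz k).1)%N.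
have nE : 3 * n%:Z + 9 = 222%:Z * linA k + 86%:Z * linB k by rewrite /n; lia.
have qE : 3 * q%:Z = 147%:Z * linA k + 57%:Z * linB k by rewrite /q; lia.
have {}nE : 3 * n%:R + 9 = 222 * (linA k)%:~R + 86 * (linB k)%:~R :> R.
  by move/(congr1 (fun z : int => z%:~R : R)): nE => /=; lra.
have {}qE : 3 * q%:R = 147 * (linA k)%:~R + 57 * (linB k)%:~R :> R.
  by move/(congr1 (fun z : int => z%:~R : R)): qE => /=; lra.
have := density_expand k (222 : R) 86 147 57; rewrite -nE -qE.
have /andP[t1 t2] := theta_bounds R.
have /andP[l1 l2] := lambda_norm_le1 R k.
move: ((1 - 3 * theta) ^+ k) l1 l2 => l l1 l2.
(* The coefficient of [linB] vanishes, so only a bounded error remains. *)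
have -> : 222 * (4 / 3 - theta / 2) + 86 * (3 * theta - 1 / 2) - 147 * (4 / 3 + theta) - 57 = 0 :> R by field.
rewrite mul0r add0r => E.
have : -150 <= l * (222 * (3 * theta - 1 / 2) - 147) by nra.
lra.
Qed.

(** * Passage to the lower limit *)

Lemma limn_einf_ratio (R : realType) (r : nat -> nat) (l C : R) (N0 : nat) :
  (forall n, (N0 <= n)%N -> l * n%:R - C <= (r n)%:R) ->
  (forall N, exists2 n, (N <= n)%N & (r n)%:R <= l * n%:R + C) ->
  limn_einf (fun n => ((r n)%:R / n%:R)%:E) = l%:E.
Proof.
move=> lo up; set u := (u in limn_einf u).
(* Beyond a threshold the additive error [C] is at most [e * n], and [n = 0], where the ratio is 0
   by convention, is excluded. *)
have large (e : R) (N : nat) : 0 < e ->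
    exists2 m, (N <= m)%N & forall n, (m <= n)%N -> 0 < n%:R :> R /\ C <= e * n%:R.
  move=> e0; exists (maxn N (Num.trunc (`|C| / e)).+1); first exact: leq_maxl.
  move=> n; rewrite geq_max => /andP[_ hn].
  have n0 : 0 < n%:R :> R by rewrite ltr0n; lia.
  split; first exact: n0.
  apply: (le_trans (ler_norm C)).
  rewrite mulrC -ler_pdivrMr//; apply: (le_trans (ltW (truncnS_gt _))).
  by rewrite ler_nat.
rewrite limn_einf_lim (cvg_lim _ (@cvg_einfs_sup R u))//.
apply/eqP; rewrite eq_le; apply/andP; split.
  apply: ge_ereal_sup => _ [N _ <-]; apply/lee_addgt0Pr => e e0.
  have [m Nm hm] := large e N e0; have [n mn rn] := up m.
  have [n0 Cn] := hm n mn.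
  apply: (@le_trans _ _ (u n)).
    by apply: ereal_inf_lbound; exists n => //=; apply: leq_trans mn.
  by rewrite /u -EFinD lee_fin ler_pdivrMr//; lra.
apply/lee_subgt0Pr => e e0; have [m Nm hm] := large e N0 e0.
apply: (@le_trans _ _ (einfs u m)); last by apply: ereal_sup_ubound; exists m.
apply: le_ereal_inf_tmp => _ [n /= mn <-].
have [n0 Cn] := hm n mn; have := lo n (leq_trans Nm mn).
by rewrite /u -EFinB lee_fin ler_pdivlMr//; lra.
Qed.

Theorem theorem3p5 (R : realType) :
  rep R (sturmian ((Num.sqrt (10 : R) - 2) / 3) ((Num.sqrt (10 : R) - 1) / 3))
  = (Num.sqrt (10 : R) - 3 / 2)%:E.
Proof.
have -> : (Num.sqrt (10 : R) - 1) / 3 = theta + 1 / 3 by rewrite /theta; lra.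
have -> : Num.sqrt (10 : R) - 3 / 2 = 3 * theta + 1 / 2 by rewrite /theta; lra.
exact: limn_einf_ratio (@r_fun_lower R) (@r_fun_upper R).
Qed.
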